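(* Let $k$ be a fixed positive integer. There exists a constant $n_0(k)$ such that the following holds. If $n\geq n_0(k)$, $t$ is an integer, and $S\subseteq \{0,1,2\}^n$ has cardinality at least \[\sum_{r=n-\left\lfloor \frac{k-1}{2}\right\rfloor}^{n+\left\lceil \frac{k-1}{2}\right\rceil}\ell_{r}(n)+ t,\] then \[\mathrm{comp}(S)\geq \left(\frac{\ell_{3k-1}(n)}{\ell_{2k-1}(n)} - 1\right)t.\]
   Context: $\{0,1,2\}^n$ is the poset in which $x\leq y$ if and only if $x_j\leq y_j$ for all $1\leq j\leq n$. For $0\leq i\leq 2n$, $\ell_i(n)$ denotes the number of vectors in $\{0,1,2\}^n$ whose coordinates sum to $i$. For a subset $S$ of a poset, $\mathrm{comp}(S)$ denotes the number of (unordered) pairs of distinct elements of $S$ that are comparable. *)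

(* Defs.v *)
From HB Require Import structures.
From mathcomp Require Import all_boot all_order all_algebra.
Set Implicit Arguments. Unset Strict Implicit. Unset Printing Implicit Defensive.

Definition cube (n : nat) : finType := {ffun 'I_n -> 'I_3}.

Definition cle (n : nat) (x y : cube n) : bool := [forall j, (x j <= y j)%N].

Definition csum (n : nat) (x : cube n) : nat := (\sum_(j < n) (x j : nat))%N.

Definition ell (n i : nat) : nat := #|[set x : cube n | csum x == i]|.

Definition ncomp (n : nat) (S : {set cube n}) : nat :=
  #|[set P in powerset S | (#|P| == 2)%N &&
       [forall x in P, forall y in P, cle x y || cle y x]]|.

(* Main.v *)
Require Import Defs.
From HB Require Import structures.
From mathcomp Require Import all_boot all_order all_algebra.
From mathcomp Require Import zify ring lra.
Import Order.TTheory GRing.Theory Num.Theory.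
Set Implicit Arguments. Unset Strict Implicit. Unset Printing Implicit Defensive.
Local Open Scope ring_scope.

(** A fractional symmetric chain cover is run as a Markov chain.  Put
    [h = ceil((k-1)/2)].  From an element below rank [n], step to a uniformly
    random upper cover; reading the poset upside down gives the same rule above
    rank [n].  An element with [a] zeros, [b] ones and [c] twos receives mass
    [b/(a+b) + c/(a+b+1) <= 1] as long as [c <= a], so new mass can be injected
    at ranks at most [n-h] to bring all of them to mass exactly [1], and
    removed at ranks at least [n+h] symmetrically; the two halves fit together
    at rank [n] because there [a = c] and the mass only depends on [(a,b,c)].
    Each of the [k] middle ranks then carries the total mass [T], and every
    element has mass at most [1], with equality outside the middle ranks, so
    [|S|] minus the size of the middle ranks is at most [mass S - k T].
    Splitting the chains meeting [S] according to their first element [x] in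
    [S], the first [k] ranks from [x] on contribute at most [k] per chain, hence
    [mass S - k T] is bounded by the sum, over pairs [x < y] of [S] at distance
    at least [k], of the probability of going from [x] to [y].  Every transition
    probability is at most about [2/(n+1)], so this probability is about
    [k! (2/(n+1))^k] at most.  For [k = 1] this is exactly the constant needed
    (here [h = 0] and no error occurs); for [k >= 2] the ratio
    [ell_{3k-1} / ell_{2k-1} <= (n+3k-2)^k (2k-1)!/(3k-1)!] leaves a factor
    of at least [2] to absorb the errors. *)

(** * Substochastic kernels that raise the rank by one *)

Section GradedKernel.
Variables (R : realFieldType) (T : finType) (rk : T -> nat) (P : T -> T -> R).
Hypothesis P_ge0 : forall x y, 0 <= P x y.
Hypothesis P_rk : forall x y, P x y != 0 -> rk y = (rk x).+1.
Hypothesis P_sum : forall x, \sum_y P x y <= 1.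

Fixpoint kpow (d : nat) (x y : T) : R :=
  if d is e.+1 then \sum_z kpow e x z * P z y else (x == y)%:R.

Lemma kpow_ge0 d x y : 0 <= kpow d x y.
Proof.
elim: d y => [|d IH] y /=; first exact: ler0n.
by apply: sumr_ge0 => z _; apply: mulr_ge0.
Qed.

Lemma kpow_rk d x y : kpow d x y != 0 -> rk y = (rk x + d)%N.
Proof.
elim: d y => [|d IH] y /=; first by rewrite addn0; case: (x =P y) => [->|]; rewrite ?eqxx.
apply: contraNeq => neq; apply/eqP/big1 => z _.
have [->|/IH hz] := eqVneq (kpow d x z) 0; first exact: mul0r.
have [->|/P_rk hy] := eqVneq (P z y) 0; first exact: mulr0.
by case/eqP: neq; rewrite hy hz addnS.
Qed.

Lemma kpow_sum_le1 d x : \sum_y kpow d x y <= 1.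
Proof.
elim: d => [|d IH] /=.
  rewrite (bigD1 x) //= eqxx big1 ?addr0 // => y neq.
  by rewrite eq_sym (negbTE neq).
rewrite exchange_big /=; apply: le_trans IH; apply: ler_sum => z _.
by rewrite -mulr_sumr ler_piMr // kpow_ge0.
Qed.

Lemma kpow_add d e x y : kpow (d + e) x y = \sum_z kpow d x z * kpow e z y.
Proof.
elim: e y => [|e IH] y /=.
  rewrite addn0 (bigD1 y) //= eqxx mulr1 big1 ?addr0 // => z neq.
  by rewrite (negbTE neq) mulr0.
rewrite addnS /=; under eq_bigr => z _ do rewrite IH mulr_suml.
rewrite exchange_big /=; apply: eq_bigr => z _.
by rewrite mulr_sumr; apply: eq_bigr => w _; rewrite mulrA.
Qed.

(** The first [d - k] steps have total mass at most 1, and the last [k] steps contribute at most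
    [M]. *)
Lemma kpow_le_late M k d x y : (k <= d)%N ->
  (forall z w, kpow k z w <= M) -> kpow d x y <= M.
Proof.
move=> led leM; rewrite -(subnK led) kpow_add.
have M0 : 0 <= M by apply: le_trans (leM x y); apply: kpow_ge0.
apply: le_trans (_ : \sum_z kpow (d - k) x z * M <= _).
  by apply: ler_sum => z _; rewrite ler_wpM2l ?kpow_ge0.
by rewrite -mulr_suml ler_piMl // kpow_sum_le1.
Qed.

(** Probability of ever reaching [y] from [x]: each step raises the rank by one, so a single power
    of the kernel counts. If [rk y < rk x], the truncated exponent 0 still gives 0. *)
Definition green (x y : T) : R := kpow (rk y - rk x) x y.

Lemma green_ge0 x y : 0 <= green x y.
Proof. exact: kpow_ge0. Qed.

Lemma greenE x y : green x y = (x == y)%:R + \sum_z green x z * P z y.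
Proof.
rewrite {1}/green; have [lexy|ltxy] := leqP (rk y) (rk x).
  have -> : (rk y - rk x = 0)%N by lia.
  rewrite /= big1 ?addr0 // => z _.
  have [->|/P_rk hy] := eqVneq (P z y) 0; first exact: mulr0.
  have -> : green x z = 0; last exact: mul0r.
  apply: contra_eq lexy => /kpow_rk; lia.
have -> : (x == y) = false by apply: contraTF ltxy => /eqP ->; rewrite ltnn.
rewrite (_ : (rk y - rk x)%N = (rk y - (rk x).+1).+1) /=; last by lia.
rewrite add0r; apply: eq_bigr => z _.
have [->|/P_rk hy] := eqVneq (P z y) 0; first by rewrite !mulr0.
by rewrite /green hy subSS.
Qed.

Variables (S : {set T}) (iota : T -> R).

Fixpoint arrive_rec (d : nat) (y : T) : R :=
  iota y + if d is e.+1 then \sum_(x | x \notin S) arrive_rec e x * P x y else 0.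

(* The mass reaching [y] without having visited [S] before, when the kernel is
   fed with the initial mass [iota]. *)
Definition arrive (y : T) : R := arrive_rec (rk y) y.

Lemma arriveE y :
  arrive y = iota y + \sum_(x | x \notin S) arrive x * P x y.
Proof.
rewrite {1}/arrive; case ey: (rk y) => [|d] /=; congr (_ + _).
  rewrite big1 // => x _.
  have [->|/P_rk] := eqVneq (P x y) 0; first exact: mulr0.
  by rewrite ey.
apply: eq_bigr => x _; have [->|/P_rk] := eqVneq (P x y) 0.
  by rewrite !mulr0.
by rewrite ey /arrive => -[->].
Qed.

Hypothesis iota_ge0 : forall x, 0 <= iota x.

Lemma arrive_ge0 y : 0 <= arrive y.
Proof.
rewrite /arrive; move: (rk y) => d; elim: d y => [|d IH] y /=; rewrite addr_ge0 //.
by apply: sumr_ge0 => x _; rewrite mulr_ge0.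
Qed.

(** Points outside [S] pass on at most what arrives there, so the mass stopped at [S] is at most the
    mass injected. *)
Lemma arrive_sum : \sum_(x in S) arrive x <= \sum_x iota x.
Proof.
have -> : \sum_x iota x = \sum_y arrive y
    - \sum_(x | x \notin S) arrive x * \sum_y P x y.
  under [X in _ - X]eq_bigr => x _ do rewrite mulr_sumr.
  rewrite exchange_big /= -sumrB; apply: eq_bigr => y _.
  by rewrite [arrive y]arriveE addrK.
rewrite [X in _ <= X - _](bigID (mem S)) /= -addrA lerDl subr_ge0.
by apply: ler_sum => x _; rewrite ler_piMr // arrive_ge0.
Qed.

Variable m : T -> R.
Hypothesis m_flow : forall y, m y = iota y + \sum_x m x * P x y.

(** Mass at [y] either has not met [S] before or is sorted by its first visit [x] in [S];
    subtracting the identity removes the case [x = y], which [arrive y] already counts. *)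
Lemma flow_decomposition y :
  m y = arrive y + \sum_(x in S) arrive x * (green x y - (x == y)%:R).
Proof.
have [d] := ubnP (rk y); elim: d y => // d IH y; rewrite ltnS => le_yd.
rewrite m_flow arriveE -addrA; congr (_ + _).
transitivity (\sum_z (arrive z
    + \sum_(x in S) arrive x * (green x z - (x == z)%:R)) * P z y).
  apply: eq_bigr => z _; have [->|/P_rk hy] := eqVneq (P z y) 0.
    by rewrite !mulr0.
  by rewrite IH // -hy.
under eq_bigr => z _ do rewrite mulrDl mulr_suml.
rewrite big_split exchange_big /= [X in X + _ = _](bigID (mem S)) /=.
rewrite addrAC [RHS]addrC; congr (_ + _); rewrite -big_split /=.
apply: eq_bigr => x xS; rewrite greenE addrAC subrr add0r mulr_sumr.
rewrite (bigD1 x) //= eqxx [X in _ = X](bigD1 x) //= addrA; congr (_ + _).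
  by rewrite mulrA; ring.
by apply: eq_bigr => z neq; rewrite eq_sym (negbTE neq) subr0 mulrA.
Qed.

Lemma arrive_le y : arrive y <= m y.
Proof.
rewrite flow_decomposition lerDl sumr_ge0 // => x _.
rewrite mulr_ge0 ?arrive_ge0 // greenE addrAC subrr add0r.
by rewrite sumr_ge0 // => z _; rewrite mulr_ge0 ?green_ge0.
Qed.

Lemma green_near_sum k x : \sum_(y | (rk y < rk x + k)%N) green x y <= k%:R.
Proof.
apply: le_trans (_ : \sum_y \sum_(d < k) kpow d x y <= _); last first.
  have -> : k%:R = \sum_(d < k) 1 :> R by rewrite sumr_const card_ord.
  by rewrite exchange_big; apply: ler_sum => d _; apply: kpow_sum_le1.
rewrite [leLHS]big_mkcond /=; apply: ler_sum => y _; case: ifP => [lty|_].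
  have [lexy|ltyx] := leqP (rk x) (rk y).
    have lt : (rk y - rk x < k)%N by lia.
    rewrite (bigD1 (Ordinal lt)) //= lerDl sumr_ge0 // => d _.
    exact: kpow_ge0.
  have -> : green x y = 0.
    by apply: contra_eq _ ltyx => /kpow_rk; lia.
  by apply: sumr_ge0 => d _; apply: kpow_ge0.
by apply: sumr_ge0 => d _; apply: kpow_ge0.
Qed.

(* Splitting the flow at the first visit to [S]. *)
Lemma flow_on_set_le k : (forall x, m x <= 1) ->
  \sum_(y in S) m y <= k%:R * \sum_x iota x
    + \sum_(x in S) \sum_(y in S | (rk x + k <= rk y)%N) green x y.
Proof.
move=> m_le1.
have -> : \sum_(y in S) m y = \sum_(x in S) arrive x * \sum_(y in S) green x y.
  under [RHS]eq_bigr => x _ do rewrite mulr_sumr.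
  rewrite exchange_big /=; apply: eq_bigr => y yS.
  rewrite flow_decomposition; under [X in _ + X]eq_bigr => x _ do rewrite mulrBr.
  rewrite sumrB; have -> : \sum_(x in S) arrive x * (x == y)%:R = arrive y.
    rewrite (bigD1 y) //= eqxx mulr1 big1 ?addr0 // => x /andP[_ neq].
    by rewrite (negbTE neq) mulr0.
  by rewrite addrC subrK.
apply: le_trans (_ : \sum_(x in S) (arrive x * k%:R
    + \sum_(y in S | (rk x + k <= rk y)%N) green x y) <= _).
  apply: ler_sum => x xS.
  rewrite (bigID (fun y => (rk x + k <= rk y)%N)) /= mulrDr addrC.
  apply: lerD; last first.
    (* At distance at least [k] the weight is replaced by its bound [arrive x <= m x <= 1]. *)
    rewrite ler_piMl ?(le_trans (arrive_le x)) //.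
    by apply: sumr_ge0 => y _; apply: green_ge0.
  rewrite ler_wpM2l ?arrive_ge0 //; apply: le_trans (green_near_sum k x).
  rewrite [leRHS](bigID (mem S)) /= (eq_bigl (fun y => (rk y < rk x + k)%N && (y \in S))).
    by rewrite lerDl sumr_ge0 // => y _; apply: green_ge0.
  by move=> y; rewrite -ltnNge andbC.
rewrite big_split /= lerD2r -mulr_suml mulrC.
by rewrite ler_wpM2l ?ler0n // arrive_sum.
Qed.

(** Below rank [top] no mass is lost, so a level carries all that was injected up to it. *)
Lemma level_mass (top : nat) : (forall x, (rk x < top)%N -> \sum_y P x y = 1) ->
  forall j, (j <= top)%N ->
  \sum_(x | rk x == j) m x = \sum_(x | (rk x <= j)%N) iota x.
Proof.
move=> P_sum1; elim=> [|j IH] lej.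
  rewrite (eq_bigl (fun x => rk x <= 0)%N) => [|x]; last by rewrite leqn0.
  apply: eq_bigr => y; rewrite leqn0 => /eqP y0; rewrite m_flow big1 ?addr0 //.
  move=> x _; have [->|/P_rk] := eqVneq (P x y) 0; first exact: mulr0.
  by rewrite y0.
rewrite (eq_bigr _ (fun y _ => m_flow y)) big_split /=.
rewrite [RHS](bigID (fun x => rk x == j.+1)) /=; congr (_ + _).
  by apply: eq_bigl => x; apply/eqP/andP => [->|[_ /eqP]].
transitivity (\sum_(x | rk x == j) m x); last first.
  rewrite (IH (ltnW lej)); apply: eq_bigl => x.
  by rewrite [(rk x <= j.+1)%N]leq_eqVlt ltnS; case: ltngtP => //; lia.
rewrite exchange_big /= [RHS]big_mkcond /=; apply: eq_bigr => x _.
case: eqP => [xj|xj]; last first.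
  rewrite big1 // => y /eqP yj.
  have [->|/P_rk] := eqVneq (P x y) 0; first exact: mulr0.
  by rewrite yj => -[/esym].
rewrite -mulr_sumr -[RHS]mulr1 -(P_sum1 x) ?xj // big_mkcond /=.
congr (_ * _); apply: eq_bigr => y _; case: eqP => // yj.
by apply/esym/eqP; apply: contraPT yj => /P_rk ->; rewrite xj; apply.
Qed.
End GradedKernel.

(** * Covers, complements and coordinate counts in the cube *)

Definition cov n (x y : cube n) : bool := cle x y && (csum y == (csum x).+1).

Definition cnt n (v : nat) (x : cube n) : nat := (\sum_(j < n) (x j == v :> nat))%N.

Definition bump n (x : cube n) (j : 'I_n) : cube n :=
  [ffun i => if i == j then inord (x i).+1 else x i].

Definition compl n (x : cube n) : cube n := [ffun j => rev_ord (x j)].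

Lemma val_le2 n (x : cube n) j : (x j <= 2)%N.
Proof. by rewrite -ltnS ltn_ord. Qed.

Lemma bumpE n (x : cube n) j i : (x j < 2)%N -> bump x j i = (x i + (i == j))%N :> nat.
Proof.
move=> lt2; rewrite ffunE; case: eqP => [->|_] /=; last by rewrite addn0.
by rewrite inordK ?addn1.
Qed.

Lemma complE n (x : cube n) i : compl x i = (2 - x i)%N :> nat.
Proof. by rewrite ffunE. Qed.

Lemma complK n : involutive (@compl n).
Proof. by move=> x; apply/ffunP => i; rewrite !ffunE rev_ordK. Qed.

Lemma cle_compl n (x y : cube n) : cle (compl x) (compl y) = cle y x.
Proof.
apply/forallP/forallP => le j; have := le j; rewrite ?complE;
  have := val_le2 x j; have := val_le2 y j; lia.
Qed.

Lemma cle_trans n (y x z : cube n) : cle x y -> cle y z -> cle x z.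
Proof.
by move=> /forallP xy /forallP yz; apply/forallP => j; apply: leq_trans (yz j).
Qed.

Lemma cle_refl n (x : cube n) : cle x x.
Proof. exact/forallP. Qed.

Lemma cnt_total n (x : cube n) : (cnt 0 x + cnt 1 x + cnt 2 x)%N = n.
Proof.
rewrite -!big_split /= -[RHS]card_ord -sum1_card; apply: eq_bigr => j _.
by have := val_le2 x j; case: (nat_of_ord (x j)) => [|[|[|]]].
Qed.

Lemma csum_cnt n (x : cube n) : csum x = (cnt 1 x + 2 * cnt 2 x)%N.
Proof.
rewrite big_distrr -big_split /=; apply: eq_bigr => j _.
by have := val_le2 x j; case: (nat_of_ord (x j)) => [|[|[|]]].
Qed.

Lemma cnt_compl n (x : cube n) v : (v <= 2)%N -> cnt v (compl x) = cnt (2 - v) x.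
Proof.
move=> lev; apply: eq_bigr => j _; rewrite complE; congr nat_of_bool.
by have le2 := val_le2 x j; apply/eqP/eqP; lia.
Qed.

Lemma csum_compl n (x : cube n) : csum (compl x) = (2 * n - csum x)%N.
Proof.
rewrite csum_cnt !cnt_compl //= csum_cnt.
by have := cnt_total x; rewrite -[(2 - 1)%N]/1%N subnn; lia.
Qed.

Lemma csum_le n (x : cube n) : (csum x <= 2 * n)%N.
Proof. by have := cnt_total x; rewrite csum_cnt; lia. Qed.

Lemma cov_compl n (x y : cube n) : cov (compl x) (compl y) = cov y x.
Proof.
rewrite /cov cle_compl !csum_compl; congr (_ && _).
have lex := csum_le x; have ley := csum_le y; apply/eqP/eqP; lia.
Qed.

Lemma csum_bump n (x : cube n) j : (x j < 2)%N -> csum (bump x j) = (csum x).+1.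
Proof.
move=> lt2; rewrite /csum (eq_bigr _ (fun i _ => bumpE i lt2)) big_split /=.
rewrite -[RHS]addn1; congr (_ + _)%N; rewrite (bigD1 j) //= eqxx big1 //.
by move=> i neq; rewrite (negbTE neq).
Qed.

Lemma cnt_bump n (x : cube n) j v : (x j < 2)%N ->
  (cnt v (bump x j) + (x j == v :> nat) = cnt v x + ((x j).+1 == v))%N.
Proof.
move=> lt2; rewrite /cnt (bigD1 j) //= [in RHS](bigD1 j) //= bumpE // eqxx addn1.
rewrite (eq_bigr (fun i => nat_of_bool (x i == v :> nat))); last first.
  by move=> i neq; rewrite bumpE // (negbTE neq) addn0.
by rewrite addnAC [RHS]addnC addnA addnAC.
Qed.

Lemma cov_bumpP n (x y : cube n) :
  reflect (exists2 j, (x j < 2)%N & y = bump x j) (cov x y).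
Proof.
apply: (iffP andP) => [[/forallP lexy /eqP sy]|[j lt2 ->]]; last first.
  split; last by rewrite csum_bump.
  by apply/forallP => i; rewrite bumpE // leq_addr.
have [j ltj] : exists j, (x j < y j)%N.
  apply/existsP; apply: contra_eqT sy; rewrite negb_exists => /forallP ge.
  rewrite neq_ltn ltnS; apply/orP; left; apply: leq_sum => i _.
  by rewrite leqNgt.
have lt2 : (x j < 2)%N by apply: leq_trans ltj (val_le2 y j).
(* [bump x j] lies below [y] coordinatewise and has the same sum, so the equality case of the summed
   inequalities forces equality. *)
exists j => //; have le_by i : (bump x j i <= y i ?= iff (bump x j i == y i :> nat))%N.
  apply: leqif_eq; rewrite bumpE //; case: eqP => [->|_]; rewrite ?addn1 //.
  by rewrite addn0.
have := leqif_sum (fun i (_ : true) => le_by i).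
move=> [_]; rewrite -/(csum y) sy -(csum_bump lt2) eqxx => /esym /forallP eqb.
by apply/ffunP => i; apply/val_inj/esym/eqP/(implyP (eqb i)).
Qed.

Lemma sum_cov n (V : nmodType) (F : cube n -> V) x :
  \sum_(y | cov x y) F y = \sum_(j | (x j < 2)%N) F (bump x j).
Proof.
transitivity (\sum_(y in [set bump x j | j in [set j | (x j < 2)%N]]) F y).
  apply: eq_bigl => y; apply/cov_bumpP/imsetP => -[j lt2 ->]; exists j => //;
    by rewrite inE in lt2 *.
rewrite big_imset /=; first by apply: eq_bigl => j; rewrite inE.
move=> i j; rewrite !inE => lti ltj /(congr1 (fun f : cube n => nat_of_ord (f i))).
by rewrite !bumpE // eqxx; case: eqP => // _; lia.
Qed.

Lemma sum_cov_down n (V : nmodType) (F : cube n -> V) y :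
  \sum_(x | cov x y) F x = \sum_(j | (0 < y j)%N) F (compl (bump (compl y) j)).
Proof.
rewrite (reindex_inj (can_inj (@complK n))) /=.
under eq_bigl => x do rewrite -cov_compl complK.
rewrite sum_cov; apply: eq_bigl => j; rewrite complE.
by case: (nat_of_ord (y j)) (val_le2 y j) => [|[|[|]]].
Qed.

(** A raised zero turns the counts (a, b, c) into (a-1, b+1, c), a raised one into (a, b-1, c+1). A
    truncated predecessor only occurs with coefficient 0. *)
Lemma sum_cov_cnt n (g : nat -> nat -> nat -> rat) (x : cube n) :
  \sum_(y | cov x y) g (cnt 0 y) (cnt 1 y) (cnt 2 y) =
    (cnt 0 x)%:R * g (cnt 0 x).-1 (cnt 1 x).+1 (cnt 2 x)
    + (cnt 1 x)%:R * g (cnt 0 x) (cnt 1 x).-1 (cnt 2 x).+1.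
Proof.
rewrite sum_cov !natr_sum !mulr_suml -big_split /= big_mkcond /=.
apply: eq_bigr => j _; have := val_le2 x j.
case: ifP => lt2; last first.
  by case: (nat_of_ord (x j)) lt2 => [|[|[|]]] // _ _; rewrite !mul0r addr0.
have := cnt_bump 0 lt2; have := cnt_bump 1 lt2; have := cnt_bump 2 lt2.
case: (nat_of_ord (x j)) lt2 => [|[|]] //= _ e2 e1 e0 _; rewrite ?mul0r ?mul1r ?addr0 ?add0r.
  by congr g; lia.
by congr g; lia.
Qed.

Lemma sum_cov_down_cnt n (g : nat -> nat -> nat -> rat) (y : cube n) :
  \sum_(x | cov x y) g (cnt 0 x) (cnt 1 x) (cnt 2 x) =
    (cnt 1 y)%:R * g (cnt 0 y).+1 (cnt 1 y).-1 (cnt 2 y)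
    + (cnt 2 y)%:R * g (cnt 0 y) (cnt 1 y).+1 (cnt 2 y).-1.
Proof.
rewrite (reindex_inj (can_inj (@complK n))) /=.
under eq_bigl => x do rewrite -cov_compl complK.
under eq_bigr => x _ do rewrite !cnt_compl //.
by rewrite (sum_cov_cnt (fun a b c => g c b a)) !cnt_compl //= addrC.
Qed.

(** A lower cover of [y] above [x] lowers a coordinate with [x j < y j], and there are at most
    [csum y - csum x] of these. Iterated, this bounds the number of saturated chains by a
    factorial. *)
Lemma card_cov_interval n (x y : cube n) : cle x y ->
  (\sum_(z | cov z y) cle x z <= csum y - csum x)%N.
Proof.
move=> /forallP lexy.
have -> : (\sum_(z | cov z y) cle x z =
    \sum_(j | 0 < y j) cle x (compl (bump (compl y) j)))%N by exact: sum_cov_down.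
apply: (@leq_trans (\sum_j (y j - x j))%N); last first.
  rewrite leq_eqVlt -(eqn_add2r (csum x)) subnK; last exact: leq_sum.
  by rewrite /csum -big_split /= (eq_bigr _ (fun i _ => subnK (lexy i))) eqxx.
rewrite big_mkcond; apply: leq_sum => j _; case: ifP => // y0.
case: (boolP (cle _ _)) => // /forallP /(_ j).
rewrite complE bumpE ?eqxx ?complE; have := val_le2 y j; lia.
Qed.

(** * Bounds on the mass recursion *)

(* The mass of an element with [a] zeros, [b] ones and [c] twos lying [s] ranks
   above rank [n - h], below rank [n]; the truncated subtractions in [mass] give
   [s = 0] at the outer ranks. *)
Fixpoint mrec (s a b c : nat) : rat :=
  if s is s'.+1 then
    b%:R / (a + b)%:R * mrec s' a.+1 b.-1 c
    + c%:R / (a + b).+1%:R * mrec s' a b.+1 c.-1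
  else 1.

Lemma mrec_ge0 s a b c : 0 <= mrec s a b c.
Proof.
elim: s a b c => [|s IH] a b c //=.
by rewrite addr_ge0 // mulr_ge0 // divr_ge0 // ler0n.
Qed.

Lemma mrec_le1 s a b c : (c <= a)%N -> mrec s a b c <= 1.
Proof.
elim: s a b c => [|s IH] a b c //= ca.
apply: (@le_trans _ _ (b%:R / (a + b)%:R + c%:R / (a + b).+1%:R)).
  by apply: lerD; rewrite ler_piMr ?divr_ge0 ?ler0n // IH //; lia.
(* Only [a = 0] can make [a + b] vanish. For [a > 0], c/(a+b+1) <= a/(a+b) completes the sum to
   1. *)
have [a0|a_gt0] := posnP a.
  have -> : c = 0%N by lia.
  rewrite mul0r addr0 a0 add0n; case: b => [|b]; first by rewrite mul0r.
  by rewrite divff // pnatr_eq0.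
have cR : (c%:R : rat) <= a%:R by rewrite ler_nat.
have bR : (0 : rat) <= b%:R by rewrite ler0n.
have aR : (0 : rat) < a%:R by rewrite ltr0n.
apply: (@le_trans _ _ (b%:R / (a + b)%:R + a%:R / (a + b)%:R)).
  rewrite lerD2l; apply: ler_pM; rewrite ?ler0n ?invr_ge0 ?ler0n //.
  by rewrite lef_pV2 ?posrE ?ltr0n ?ler_nat //; lia.
rewrite -mulrDl -natrD addnC divff // pnatr_eq0; lia.
Qed.

(** [e = a - c] is the distance below the middle rank; a recursion step raises it by one. The
    coefficients add up to at least (b+c)/(a+b+1) = 1 - (e+1)/(a+b+1), where e+1 <= h and 2(a+b+1)
    >= n. *)
Lemma mrec_ge n h s a b c e : (2 * h < n)%N ->
  a = (c + e)%N -> (e + s <= h)%N -> (a + b + c)%N = n ->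
  (1 - (2 * h)%:R / n%:R) ^+ s <= mrec s a b c.
Proof.
move=> hn; set L := 1 - _.
have n0 : (0 : rat) < n%:R by rewrite ltr0n; lia.
have L0 : 0 <= L by rewrite subr_ge0 ler_pdivrMr // mul1r ler_nat ltnW.
elim: s a b c e => [|s IH] a b c e eqa les eqn //=.
apply: (@le_trans _ _ (b%:R / (a + b)%:R * L ^+ s + c%:R / (a + b).+1%:R * L ^+ s)).
  rewrite -mulrDl exprS ler_wpM2r ?exprn_ge0 //.
  apply: (@le_trans _ _ (b%:R / (a + b).+1%:R + c%:R / (a + b).+1%:R)).
    rewrite -mulrDl ler_pdivlMr ?ltr0n // /L mulrBl mul1r.
    rewrite lerBlDr -lerBlDl -natrD mulrAC ler_pdivlMr //.
    rewrite -natrB; last by lia.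
    by rewrite -!natrM ler_nat; nia.
  rewrite lerD2r; case: b eqn => [|b] eqn; first by rewrite !mul0r.
  rewrite ler_wpM2l ?ler0n // lef_pV2 ?posrE ?ltr0n ?ler_nat //; lia.
apply: lerD.
  case: b eqn => [|b] eqn; first by rewrite !mul0r.
  by rewrite ler_wpM2l ?divr_ge0 ?ler0n // (IH _ _ _ e.+1) //=; lia.
case: c eqa eqn => [|c] eqa eqn; first by rewrite !mul0r.
by rewrite ler_wpM2l ?divr_ge0 ?ler0n // (IH _ _ _ e.+1) //=; lia.
Qed.

(** * The mass function and its transition kernel *)

Section Mass.
Variables n h : nat.
Hypothesis hn : (2 * h < n)%N.
Implicit Types x y z : cube n.

Definition mass x : rat :=
  if (csum x <= n)%N then mrec (csum x - (n - h)) (cnt 0 x) (cnt 1 x) (cnt 2 x)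
  else mrec (2 * n - csum x - (n - h)) (cnt 2 x) (cnt 1 x) (cnt 0 x).

(** From rank [n] on this is a time reversal: the mass of [y] is drawn equally from its lower
    covers, so [mass x * kern x y] is [mass y] divided by their number. *)
Definition kern x y : rat :=
  if ~~ cov x y then 0 else
  if (csum x < n)%N then (cnt 0 x + cnt 1 x)%:R^-1
  else mass y / mass x / (cnt 1 y + cnt 2 y)%:R.

Lemma mass_compl x : mass (compl x) = mass x.
Proof.
rewrite /mass csum_compl !cnt_compl // subnn -[(2 - 1)%N]/1%N subn0.
have cx := csum_cnt x; have tx := cnt_total x.
have [ltx|gtx|eqx] := ltngtP (csum x) n.
- have -> : (2 * n - csum x <= n)%N = false by lia.
  by congr mrec; lia.
- by have -> : (2 * n - csum x <= n)%N by lia.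
- have -> : (2 * n - csum x <= n)%N by lia.
  by congr mrec; lia.
Qed.

Let lam : rat := (1 - (2 * h)%:R / n%:R) ^+ h.

Lemma mass_lower_ge x : (csum x <= n)%N -> lam <= mass x.
Proof.
move=> lex; rewrite /mass lex.
have n0 : (0 : rat) < n%:R by rewrite ltr0n; lia.
have L0 : 0 <= 1 - (2 * h)%:R / n%:R :> rat.
  by rewrite subr_ge0 ler_pdivrMr // mul1r ler_nat ltnW.
have L1 : 1 - (2 * h)%:R / n%:R <= 1 :> rat by rewrite gerBl divr_ge0 ?ler0n.
have cx := csum_cnt x; have tx := cnt_total x.
have [small|big] := leqP (csum x) (n - h).
  have -> : (csum x - (n - h) = 0)%N by lia.
  exact: exprn_ile1.
apply: le_trans (mrec_ge (n := n) (h := h) (e := n - csum x) _ _ _ _); try lia.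
by apply: ler_wiXn2l => //; lia.
Qed.

Lemma lam_gt0 : 0 < lam.
Proof.
have n0 : (0 : rat) < n%:R by rewrite ltr0n; lia.
by rewrite exprn_gt0 // subr_gt0 ltr_pdivrMr // mul1r ltr_nat.
Qed.

Lemma mass_ge x : lam <= mass x.
Proof.
have [lex|gtx] := leqP (csum x) n; first exact: mass_lower_ge.
rewrite -mass_compl; apply: mass_lower_ge; rewrite csum_compl; lia.
Qed.

Lemma mass_gt0 x : 0 < mass x.
Proof. exact: lt_le_trans lam_gt0 (mass_ge x). Qed.

Lemma mass_le1 x : mass x <= 1.
Proof.
have cx := csum_cnt x; have tx := cnt_total x.
by rewrite /mass; case: leqP => lex; apply: mrec_le1; lia.
Qed.

Lemma mass_outer x : (csum x <= n - h)%N || (n + h <= csum x)%N -> mass x = 1.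
Proof.
move=> out; rewrite /mass; case: leqP => lex.
  by rewrite (_ : (_ - _)%N = 0%N) //; lia.
by rewrite (_ : (_ - (n - h))%N = 0%N) //; lia.
Qed.

(** With (a, b, c) the counts of [y], lowering a one gives an element with a+b upper covers,
    lowering a two one with a+b+1: this is the recursion of [mrec]. *)
Lemma inflow y : (0 < csum y <= n)%N ->
  \sum_(x | cov x y) mass x / (cnt 0 x + cnt 1 x)%:R
    = mrec (csum y - 1 - (n - h)).+1 (cnt 0 y) (cnt 1 y) (cnt 2 y).
Proof.
move=> /andP[y0 lyn].
pose g a b c := mrec (csum y - 1 - (n - h)) a b c / (a + b)%:R.
transitivity (\sum_(x | cov x y) g (cnt 0 x) (cnt 1 x) (cnt 2 x)).
  apply: eq_bigr => x /andP[_ /eqP ey]; rewrite /g /mass ey subn1 /=.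
  by have -> : (csum x <= n)%N by lia.
rewrite (sum_cov_down_cnt g) /g /=; congr (_ + _); last by rewrite addnS mulrA mulrAC.
case: (cnt 1 y) => [|b]; first by rewrite !mul0r.
by rewrite mulrA mulrAC /= addSnnS.
Qed.

Lemma inflow_le y : (csum y <= n)%N ->
  \sum_(x | cov x y) mass x / (cnt 0 x + cnt 1 x)%:R <= mass y.
Proof.
move=> lyn; have [y0|y0] := posnP (csum y).
  rewrite big1 ?(ltW (mass_gt0 y)) // => x /andP[_ /eqP].
  by rewrite y0.
rewrite inflow ?y0 //.
have [out|big] := leqP (csum y) (n - h).
  rewrite mass_outer ?out //; apply: mrec_le1.
  by have := csum_cnt y; have := cnt_total y; lia.
by rewrite /mass lyn (_ : (csum y - 1 - (n - h)).+1 = (csum y - (n - h))%N) //; lia.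
Qed.

Lemma inflow_eq y : (n - h < csum y <= n)%N ->
  \sum_(x | cov x y) mass x / (cnt 0 x + cnt 1 x)%:R = mass y.
Proof.
move=> /andP[big lyn]; rewrite inflow; last by lia.
by rewrite /mass lyn (_ : (csum y - 1 - (n - h)).+1 = (csum y - (n - h))%N) //; lia.
Qed.

Lemma kern_ge0 x y : 0 <= kern x y.
Proof.
rewrite /kern; case: ifP => // _; case: ifP => _.
  by rewrite invr_ge0 ler0n.
by rewrite !divr_ge0 ?ler0n // ltW ?mass_gt0.
Qed.

Lemma kern_cov x y : kern x y != 0 -> cov x y.
Proof. by rewrite /kern; case: cov; rewrite ?eqxx. Qed.

Lemma kern_rk x y : kern x y != 0 -> csum y = (csum x).+1.
Proof. by move=> /kern_cov /andP[_ /eqP]. Qed.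

Lemma sum_kern_lower x : (csum x < n)%N -> \sum_y kern x y = 1.
Proof.
move=> ltx.
have -> : \sum_y kern x y = \sum_(y | cov x y) (cnt 0 x + cnt 1 x)%:R^-1.
  rewrite [RHS]big_mkcond; apply: eq_bigr => y _.
  by rewrite /kern ltx; case: cov.
rewrite (sum_cov_cnt (fun _ _ _ => _)) -mulrDl -natrD divff // pnatr_eq0.
by have := csum_cnt x; have := cnt_total x; lia.
Qed.

Lemma sum_kern_upper x : (n <= csum x)%N -> \sum_y kern x y =
  (\sum_(y | cov y (compl x)) mass y / (cnt 0 y + cnt 1 y)%:R) / mass x.
Proof.
move=> gex; rewrite mulr_suml (reindex_inj (can_inj (@complK n))) /=.
rewrite [RHS]big_mkcond; apply: eq_bigr => y _.
rewrite -[cov y _]cov_compl complK /kern ltnNge gex /=; case: cov => //=.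
by rewrite mass_compl !cnt_compl //= addnC mulrAC.
Qed.

Lemma sum_kern_le1 x : \sum_y kern x y <= 1.
Proof.
have [ltx|gex] := ltnP (csum x) n; first by rewrite sum_kern_lower.
rewrite sum_kern_upper // ler_pdivrMr ?mass_gt0 // mul1r -(mass_compl x).
by apply: inflow_le; rewrite csum_compl; lia.
Qed.

Lemma sum_kern_eq1 x : (csum x < n + h)%N -> \sum_y kern x y = 1.
Proof.
move=> lex; have [ltx|gex] := ltnP (csum x) n; first by rewrite sum_kern_lower.
rewrite sum_kern_upper // inflow_eq ?mass_compl ?divff ?gt_eqF ?mass_gt0 //.
by rewrite csum_compl; lia.
Qed.

(** The injected mass: the excess over the inflow, shown below to vanish above rank [n - h]. *)
Definition init y : rat := mass y - \sum_x mass x * kern x y.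

Lemma inflow_kern_lower y : (csum y <= n)%N -> \sum_x mass x * kern x y =
  \sum_(x | cov x y) mass x / (cnt 0 x + cnt 1 x)%:R.
Proof.
move=> lyn; rewrite [RHS]big_mkcond; apply: eq_bigr => x _.
rewrite /kern; case: (boolP (cov x y)) => [/andP[_ /eqP ey]|_] /=; last by rewrite mulr0.
by have -> : (csum x < n)%N by rewrite -ey.
Qed.

Lemma inflow_kern_upper y : (n < csum y)%N -> \sum_x mass x * kern x y = mass y.
Proof.
move=> gtn; transitivity (\sum_(x | cov x y) mass y / (cnt 1 y + cnt 2 y)%:R).
  rewrite [RHS]big_mkcond; apply: eq_bigr => x _.
  rewrite /kern; case: (boolP (cov x y)) => [/andP[_ /eqP ey]|_] /=; last by rewrite mulr0.
  have -> : (csum x < n)%N = false by lia.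
  by rewrite !mulrA [mass x * mass y]mulrC mulfK // gt_eqF ?mass_gt0.
rewrite (sum_cov_down_cnt (fun _ _ _ => _)) -mulrDl -natrD mulrCA divff ?mulr1 //.
by rewrite pnatr_eq0; have := csum_cnt y; lia.
Qed.

Lemma init_ge0 y : 0 <= init y.
Proof.
rewrite subr_ge0; have [ley|gty] := leqP (csum y) n.
  by rewrite inflow_kern_lower // inflow_le.
by rewrite inflow_kern_upper.
Qed.

Lemma init_eq0 y : (n - h < csum y)%N -> init y = 0.
Proof.
move=> lty; apply/eqP; rewrite subr_eq0 eq_sym; have [ley|gty] := leqP (csum y) n.
  by rewrite inflow_kern_lower // inflow_eq ?lty.
by rewrite inflow_kern_upper.
Qed.

Lemma mass_flow y : mass y = init y + \sum_x mass x * kern x y.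
Proof. by rewrite subrK. Qed.

(** The relevant number of covers exceeds n/2: below rank [n] there are more zeros than twos, above
    it more twos than zeros. The upper half costs an extra [mass y / mass x <= 1 / lam]. *)
Lemma kern_le x y : kern x y <= 2 / n.+1%:R / lam.
Proof.
have n1 : (0 : rat) < n.+1%:R by rewrite ltr0n.
have lam1 : lam <= 1 by apply: le_trans (mass_ge x) (mass_le1 x).
have l0 := lam_gt0.
have half N : (n < 2 * N)%N -> (N%:R : rat)^-1 <= 2 / n.+1%:R.
  move=> gt; rewrite ler_pdivlMr // ler_pdivrMl ?ltr0n; last by lia.
  by rewrite mulrC -natrM ler_nat.
have le2 : 2 / n.+1%:R <= 2 / n.+1%:R / lam.
  by rewrite ler_pdivlMr // ler_piMr // divr_ge0 ?ler0n.
have cx := csum_cnt x; have tx := cnt_total x.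
have cy := csum_cnt y; have ty := cnt_total y.
rewrite /kern; case: (boolP (cov x y)) => [/andP[_ /eqP ey]|_] /=; last first.
  by rewrite !divr_ge0 ?ler0n // ltW.
case: ifP => ltx; first by apply: le_trans le2; apply: half; lia.
have [my mx] := (ltW (mass_gt0 y), ltW (mass_gt0 x)).
rewrite mulrC; apply: ler_pM; rewrite ?invr_ge0 ?ler0n ?divr_ge0 //.
  by apply: half; lia.
rewrite ler_pdivrMr ?mass_gt0 // mulrC; apply: le_trans (mass_le1 y) _.
by rewrite ler_pdivlMr // mul1r mass_ge.
Qed.

(** At most d! saturated chains of length d join [x] to [y], and each weighs at most [beta ^+ d]. *)
Lemma kpow_kern_le d x y :
  kpow kern d x y <= if cle x y then d`!%:R * (2 / n.+1%:R / lam) ^+ d else 0.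
Proof.
set beta := 2 / n.+1%:R / lam.
have beta0 : 0 <= beta by rewrite !divr_ge0 ?ler0n // ltW ?lam_gt0.
elim: d y => [|d IH] y.
  rewrite /= mulr1; case: eqP => [->|_]; first by rewrite cle_refl.
  by case: ifP.
have [->|neq0] := eqVneq (kpow kern d.+1 x y) 0.
  by case: ifP => // _; rewrite mulr_ge0 ?ler0n ?exprn_ge0.
have rk := kpow_rk kern_rk neq0.
apply: (@le_trans _ _ (\sum_(z | cov z y) (cle x z)%:R * (d`!%:R * beta ^+ d.+1))).
  rewrite /= [leRHS]big_mkcond; apply: ler_sum => z _.
  case: ifP => [_|ncov]; last by rewrite /kern ncov mulr0.
  apply: le_trans (_ : (if cle x z then d`!%:R * beta ^+ d else 0) * beta <= _).
    apply: ler_pM; rewrite ?kern_ge0 ?kern_le //.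
    exact: kpow_ge0 kern_ge0 _ _ _.
  by case: ifP; rewrite ?mul0r // mul1r exprSr mulrA.
rewrite -mulr_suml; case: ifP => lexy; last first.
  rewrite big1 ?mul0r // => z /andP[lezy _]; case: (boolP (cle x z)) => // lexz.
  by rewrite (cle_trans lexz lezy) in lexy.
rewrite mulrA ler_wpM2r ?exprn_ge0 // factS natrM ler_wpM2r ?ler0n //.
rewrite -natr_sum ler_nat; apply: leq_trans (card_cov_interval lexy) _.
by rewrite rk; lia.
Qed.
End Mass.

(** * Ratios of consecutive level sizes *)

Lemma natr_ell n i : (ell n i)%:R = \sum_(x : cube n | csum x == i) 1 :> rat.
Proof. by rewrite sumr_const /ell cardsE. Qed.

Lemma ell_succ_sum n i : i.+1%:R * (ell n i.+1)%:R =
  \sum_(x : cube n | csum x == i) (n%:R + (cnt 1 x)%:R - (cnt 2 x)%:R) :> rat.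
Proof.
(* Give the cover (x, y), obtained by raising the coordinate j, the weight y_j. *)
pose w (x y : cube n) : rat := if cnt 2 x == cnt 2 y then 1 else 2.
transitivity (\sum_(y : cube n | csum y == i.+1) \sum_(x | cov x y) w x y).
  rewrite natr_ell mulr_sumr; apply: eq_bigr => y /eqP ey; rewrite mulr1 -ey.
  rewrite (sum_cov_down_cnt (fun _ _ c => if c == cnt 2 y then 1 else 2)) eqxx.
  rewrite csum_cnt natrD natrM mulr1 mulrC; congr (_ + _).
  case: (cnt 2 y) => [|c]; first by rewrite !mul0r.
  by rewrite -[c.+1.-1]/c ltn_eqF.
rewrite (exchange_big_dep (fun x : cube n => csum x == i)) /=; last first.
  by move=> y x /eqP ey /andP[_]; rewrite ey eqSS eq_sym.
apply: eq_bigr => x /eqP ex.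
rewrite (eq_bigl (fun y => cov x y)); last first.
  by move=> y; apply/andP/idP => [[]//|/[dup] /andP[_ /eqP ->] ->]; rewrite ex.
(* A raised zero has weight 1 and a raised one weight 2, so [x] contributes a + 2b = n + b - c. *)
rewrite (sum_cov_cnt (fun _ _ c => if cnt 2 x == c then 1 else 2)) eqxx.
rewrite ltn_eqF // -{3}(cnt_total x) !natrD; ring.
Qed.

Lemma ell_succ_le n i : (i.+1 * ell n i.+1 <= (n + i) * ell n i)%N.
Proof.
rewrite -(ler_nat rat) natrM ell_succ_sum natrM natr_ell mulr_sumr.
apply: ler_sum => x /eqP ex; rewrite mulr1 natrD -ex csum_cnt natrD.
by have c0 : (0 : rat) <= (cnt 2 x)%:R by []; rewrite natrM; lra.
Qed.

Lemma ell_succ_ge n i : (i <= n)%N -> ((n - i) * ell n i <= i.+1 * ell n i.+1)%N.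
Proof.
move=> lein; rewrite -(ler_nat rat) [in leRHS]natrM ell_succ_sum natrM natr_ell mulr_sumr.
apply: ler_sum => x /eqP ex; rewrite mulr1 natrB //.
have : (cnt 2 x <= i + cnt 1 x)%N by rewrite -ex csum_cnt; lia.
by rewrite -(ler_nat rat) natrD; lra.
Qed.

(** The successive ratios (n+m)/(m+1), i <= m < i+j, have numerators at most [B] and denominators
    with product (i+j)!/i!. *)
Lemma ell_ratio_le n i j B : (n + i + j <= B.+1)%N ->
  ((i + j)`! * ell n (i + j) <= i`! * B ^ j * ell n i)%N.
Proof.
elim: j => [|j IH] leB; first by rewrite addn0 muln1.
rewrite addnS factS mulnAC mulnC mulnA.
have := ell_succ_le n (i + j); have := IH ltac:(lia).
rewrite expnS => le1 le2.
have leq3 : ((n + (i + j)) * ell n (i + j) <= B * ell n (i + j))%N.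
  by rewrite leq_mul2r; apply/orP; right; lia.
nia.
Qed.

Lemma ell_mono n i j : (i <= j)%N -> (2 * j < n)%N -> (ell n i <= ell n j)%N.
Proof.
move=> leij; elim: j leij => [|j IH]; first by rewrite leqn0 => /eqP ->.
rewrite leq_eqVlt ltnS => /orP[/eqP -> //|leij] lt.
apply: leq_trans (IH leij _) _; first by lia.
have := @ell_succ_ge n j ltac:(lia) => le1.
rewrite -(leq_pmul2l (ltn0Sn j)); apply: leq_trans le1.
by rewrite leq_mul2r; apply/orP; right; lia.
Qed.

Lemma ell_gt0 n i : (2 * i < n)%N -> (0 < ell n i)%N.
Proof.
move=> lt; apply: leq_trans (ell_mono (leq0n i) lt).
apply/card_gt0P; exists [ffun=> ord0]; rewrite inE /csum big1 // => j _.
by rewrite ffunE.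
Qed.

(** * From masses to comparable pairs *)

Lemma sum_levels n (V : nmodType) (F : cube n -> V) p q :
  \sum_(p <= r < q) \sum_(x | csum x == r) F x =
  \sum_(x | (p <= csum x < q)%N) F x.
Proof.
rewrite (exchange_big_dep predT) //= [RHS]big_mkcond; apply: eq_bigr => x _.
rewrite -mem_index_iota; case: ifP => [inx|outx]; last first.
  rewrite big_seq_cond big1 // => r /andP[rin /eqP er].
  by rewrite er rin in outx.
rewrite (eq_bigl (pred1 (csum x))) => [|r]; last by rewrite eq_sym.
by rewrite -big_filter filter_pred1_uniq ?iota_uniq // big_seq1.
Qed.

(** The ranks tell which element of a pair is the smaller one, so forgetting the order is
    injective. *)
Lemma card_chain_pairs_le n (S : {set cube n}) :
  (\sum_(x in S) \sum_(y in S | (csum x < csum y)%N) cle x y <= ncomp S)%N.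
Proof.
pose Q := [set p : cube n * cube n |
  [&& p.1 \in S, p.2 \in S, (csum p.1 < csum p.2)%N & cle p.1 p.2]].
have -> : (\sum_(x in S) \sum_(y in S | csum x < csum y) cle x y = #|Q|)%N.
  rewrite -sum1_card pair_big_dep /= [RHS]big_mkcond [LHS]big_mkcond.
  apply: eq_bigr => -[x y] _; rewrite !inE /=.
  by case: (x \in S); case: (y \in S); case: (_ < _)%N; case: cle.
have inj : {in Q &, injective (fun p : cube n * cube n => [set p.1; p.2])}.
  move=> [x y] [x' y']; rewrite !inE /= => /and4P[_ _ lt _] /and4P[_ _ lt' _] e.
  have /set2P[ex|ex] : x \in [set x'; y'] by rewrite -e set21.
    have /set2P[ey|->] : y \in [set x'; y'] by rewrite -e set22.
      by rewrite ex ey ltnn in lt.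
    by rewrite ex.
  have /set2P[ey|ey] : y \in [set x'; y'] by rewrite -e set22.
    by move: lt; rewrite ex ey ltnNge ltnW.
  by rewrite ex ey ltnn in lt.
rewrite -(card_in_imset inj); apply: subset_leq_card; apply/subsetP => P.
case/imsetP => -[x y]; rewrite !inE /= => /and4P[xS yS lt lexy] ->.
rewrite cards2; apply/and3P; split.
- by apply/subsetP => z /set2P[] ->.
- by have [exy|//] := eqVneq x y; rewrite exy ltnn in lt.
- apply/forall_inP => z /set2P zxy; apply/forall_inP => z' /set2P zxy'.
  by case: zxy => ->; case: zxy' => ->; rewrite ?cle_refl ?lexy ?orbT.
Qed.

Lemma supersaturation_weighted n h f k (S : {set cube n}) :
  (f <= h <= f.+1)%N -> (f + h).+1 = k -> (2 * h < n)%N ->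
  (#|S|%:R : rat) - #|[set x : cube n | (n - f <= csum x < (n + h).+1)%N]|%:R
  <= k`!%:R * (2 / n.+1%:R / (1 - (2 * h)%:R / n%:R) ^+ h) ^+ k * (ncomp S)%:R.
Proof.
move=> /andP[lefh lehf] ek hn; set Mid := [set x | _]; set M := k`!%:R * _.
pose T := \sum_x @init n h x.
have M0 : 0 <= M.
  rewrite mulr_ge0 ?ler0n // exprn_ge0 // divr_ge0 ?divr_ge0 ?ler0n //.
  exact: ltW (lam_gt0 hn).
(* Injection happens at ranks up to n-h <= n-f and no mass is lost below n+h, so each of the f+h+1 =
   k middle ranks carries [T]. *)
have massMid : \sum_(x in Mid) mass h x = k%:R * T.
  rewrite (eq_bigl (fun x => (n - f <= csum x < (n + h).+1)%N)); last first.
    by move=> x; rewrite inE.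
  rewrite -sum_levels (eq_big_nat _ _ (F2 := fun=> T)); last first.
    move=> r /andP[ler ltr].
    rewrite (level_mass (@kern_rk n h) (@mass_flow n h) (top := n + h)) //.
      rewrite /T [RHS](bigID (fun x => (csum x <= r)%N)) /= [X in _ = _ + X]big1 ?addr0 //.
      by move=> x; rewrite -ltnNge => lt; apply: init_eq0 => //; lia.
    by move=> x; apply: sum_kern_eq1.
  rewrite sumr_const_nat mulr_natl; congr (_ *+ _); lia.
(* The mass is at most 1, and equal to 1 outside [Mid]: by h <= f+1, the ranks below n-f are at most
   n-h. *)
have defect : (#|S|%:R : rat) - #|Mid|%:R
    <= \sum_(x in S) mass h x - \sum_(x in Mid) mass h x.
  have cardR (A : {set cube n}) : (#|A|%:R : rat) =
      \sum_(x in A) (1 - mass h x) + \sum_(x in A) mass h x.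
    by rewrite -big_split /= (eq_bigr (fun=> 1)) ?sumr_const // => x _; rewrite subrK.
  rewrite (cardR S) (cardR Mid) opprD addrACA gerDr subr_le0.
  rewrite (big_setID Mid) /= [X in _ + X]big1 => [|x /setDP[_ out]]; last first.
    by rewrite mass_outer ?subrr //; move: out; rewrite inE; lia.
  rewrite addr0 [leRHS](big_setID S) /= setIC lerDl sumr_ge0 // => x _.
  by rewrite subr_ge0 mass_le1.
apply: le_trans defect _; rewrite massMid lerBlDl.
apply: le_trans (flow_on_set_le (@kern_ge0 n h hn) (@kern_rk n h) (@sum_kern_le1 n h hn)
  S (@init_ge0 n h hn) (@mass_flow n h) k (@mass_le1 n h hn)) _.
rewrite lerD2l; apply: le_trans (_ : M * (\sum_(x in S) \sum_(y in S |
    (csum x < csum y)%N) cle x y)%:R <= _); last first.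
  by rewrite ler_wpM2l // ler_nat card_chain_pairs_le.
rewrite natr_sum mulr_sumr; apply: ler_sum => x xS.
rewrite natr_sum mulr_sumr [leLHS]big_mkcond [leRHS]big_mkcond.
apply: ler_sum => y _; case: (y \in S) => //=.
case: ifP => far; last by case: ifP => // _; rewrite mulr_ge0 ?ler0n.
rewrite (_ : (csum x < csum y)%N); last by lia.
case: (boolP (cle x y)) => lexy; last first.
  by have := kpow_kern_le hn (csum y - csum x) x y; rewrite (negbTE lexy) mulr0.
(* Pairs at distance larger than [k] inherit the bound for exactly [k] steps. *)
rewrite mulr1 /green; apply: (kpow_le_late (kern_ge0 hn) (sum_kern_le1 hn) x y (_ : k <= _)%N); first lia.
move=> z w; apply: le_trans (kpow_kern_le hn k z w) _.
by case: ifP.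
Qed.

(** * Numerical estimates *)

Lemma bernoulli_sub (u : rat) d : 0 <= u <= 1 -> 1 - d%:R * u <= (1 - u) ^+ d.
Proof.
move=> /andP[u0 u1]; elim: d => [|d IH]; first by rewrite mul0r subr0.
rewrite exprS; apply: (@le_trans _ _ ((1 - u) * (1 - d%:R * u))); last first.
  by rewrite ler_wpM2l // subr_ge0.
have : 0 <= d%:R * u * u by rewrite !mulr_ge0 ?ler0n.
by rewrite -natr1; lra.
Qed.

(** The quotient is the product of (2k-1+i)/i for i = 1, ..., j. Every factor is at least 2, and the
    first one, 2k >= 4, supplies the additional 2. *)
Lemma fact_ratio_ge k j : (2 <= k)%N -> (0 < j <= k)%N ->
  (j`! * 2 ^ j.+1 * (2 * k).-1`! <= ((2 * k).-1 + j)`!)%N.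
Proof.
move=> k2; elim: j => // -[|j] IH /andP[_ lej].
  have -> : (1`! * 2 ^ 2 = 4)%N by [].
  by rewrite addn1 factS leq_mul2r; apply/orP; right; lia.
have le1 := IH ltac:(lia).
rewrite [j.+2`!]factS addnS [(_ + _).+1`!]factS [(2 ^ _)%N]expnS; apply: leq_trans (_ : (2 * j.+2) * ((2 * k).-1 + j.+1)`! <= _)%N.
  rewrite (_ : (_ * _)%N = (2 * j.+2) * (j.+1`! * 2 ^ j.+2 * (2 * k).-1`!))%N.
    by rewrite leq_mul2l le1 orbT.
  by set a := (2 ^ _)%N; ring.
by rewrite leq_mul2r; apply/orP; right; lia.
Qed.

(** By Bernoulli the base on the right is at least n - 2k^2 = N(1-u), with N = n+3k and u =
    (2k^2+3k)/N. Again by Bernoulli (1-u)^k >= 1 - ku >= 1/2, as 2k(2k^2+3k) <= 10k^3 <= n. *)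
Lemma pow_ratio_le n k h : (2 <= k)%N -> (h <= k)%N -> (10 * k ^ 3 <= n)%N ->
  ((n + 3 * k)%:R : rat) ^+ k
    <= 2 * (n.+1%:R * (1 - (2 * h)%:R / n%:R) ^+ h) ^+ k.
Proof.
move=> k2 lehk; rewrite !expnS expn0 muln1 => len.
have n0 : (0 : rat) < n%:R by rewrite ltr0n; nia.
set N : rat := (n + 3 * k)%:R.
have N0 : 0 < N by rewrite ltr0n; lia.
pose D : rat := (2 * k * k)%:R.
have hu : 0 <= ((2 * h)%:R / n%:R : rat) <= 1.
  by rewrite divr_ge0 ?ler0n // ler_pdivrMr // mul1r ler_nat; nia.
have lamge : n%:R - D <= n.+1%:R * (1 - (2 * h)%:R / n%:R) ^+ h.
  apply: (@le_trans _ _ (n%:R * (1 - (2 * h)%:R / n%:R) ^+ h)).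
    apply: (@le_trans _ _ (n%:R * (1 - h%:R * ((2 * h)%:R / n%:R)))).
      rewrite mulrBr mulr1 lerD2l lerN2 mulrCA [n%:R * _]mulrCA divff ?gt_eqF //.
      by rewrite mulr1 -natrM ler_nat; nia.
    by rewrite ler_wpM2l ?bernoulli_sub // ltW.
  rewrite ler_wpM2r ?ler_nat // exprn_ge0 // subr_ge0.
  by case/andP: hu.
pose u : rat := (2 * k * k + 3 * k)%:R / N.
have hu' : 0 <= u <= 1.
  by rewrite divr_ge0 ?ler0n // ler_pdivrMr // mul1r ler_nat; nia.
have eN : N * (1 - u) = n%:R - D.
  by rewrite mulrBr mulr1 /u mulrCA divff ?gt_eqF // mulr1 /N /D !natrD; ring.
have half : 1 <= 2 * (1 - u) ^+ k.
  have le1 := bernoulli_sub k hu'.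
  have : k%:R * u <= 2^-1.
    rewrite mulrA ler_pdivrMr // ler_pdivlMl ?ltr0n //.
    by rewrite -!natrM ler_nat; nia.
  lra.
apply: (@le_trans _ _ (2 * (N * (1 - u)) ^+ k)).
  by rewrite exprMn mulrCA ler_peMr // exprn_ge0 // ltW.
rewrite ler_wpM2l // lerXn2r ?nnegrE ?eN //.
  by rewrite subr_ge0 ler_nat; nia.
apply: le_trans lamge; by rewrite subr_ge0 ler_nat; nia.
Qed.

Lemma ratio_bound n k h : (0 < k)%N -> (h <= k.-1)%N -> (10 * k ^ 3 <= n)%N ->
  (ell n (3 * k).-1)%:R / (ell n (2 * k).-1)%:R *
  (k`!%:R * (2 / n.+1%:R / (1 - (2 * h)%:R / n%:R) ^+ h) ^+ k) <= 1 :> rat.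
Proof.
move=> k0 lehk len.
have len' : (10 * k <= n)%N by apply: leq_trans len; rewrite !expnS; nia.
(* The largest numerator n+m among the ratios between ranks 2k-1 and 3k-1. *)
set B := (n + 3 * k - 2)%N.
have e0 : (0 : rat) < (ell n (2 * k).-1)%:R by rewrite ltr0n ell_gt0 //; lia.
have ratio : (ell n (3 * k).-1)%:R / (ell n (2 * k).-1)%:R
    <= ((2 * k).-1`!%:R * B%:R ^+ k) / ((2 * k).-1 + k)`!%:R :> rat.
  rewrite ler_pdivrMr // mulrAC ler_pdivlMr ?ltr0n ?fact_gt0 //.
  rewrite -natrX -!natrM ler_nat mulnC.
  rewrite (_ : (3 * k).-1 = ((2 * k).-1 + k)%N); last by lia.
  by apply: ell_ratio_le; rewrite /B; lia.
set lam := (1 - _) ^+ h.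
have lam0 : 0 < lam by apply: (@lam_gt0 n h); lia.
set w : rat := n.+1%:R * lam.
have w0 : 0 < w by rewrite mulr_gt0 // ltr0n.
have -> : 2 / n.+1%:R / lam = 2 / w by rewrite /w invfM mulrA.
apply: le_trans (_ : _ * (k`!%:R * (2 / w) ^+ k) <= _).
  by apply: ler_wpM2r ratio; rewrite mulr_ge0 ?ler0n // exprn_ge0 // divr_ge0 // ltW.
rewrite expr_div_n mulrAC ler_pdivrMr ?ltr0n ?fact_gt0 // mul1r.
rewrite !mulrA ler_pdivrMr ?exprn_gt0 //.
case: (ltngtP k 1) k0 => [| k2 _|ek _]; first by lia.
  have le1 : (B%:R : rat) ^+ k <= 2 * w ^+ k.
    apply: le_trans (pow_ratio_le (h := h) k2 _ len); last by lia.
    by rewrite lerXn2r ?nnegrE ?ler0n // ler_nat /B; lia.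
  have := fact_ratio_ge k2 (j := k) ltac:(lia).
  rewrite -(ler_nat rat) !natrM natrX exprS => le2.
  set a := ((2 * k).-1)`!%:R; set b := k`!%:R.
  apply: (@le_trans _ _ (a * (2 * w ^+ k) * b * 2 ^+ k)).
    by rewrite !ler_wpM2r ?exprn_ge0 ?ler0n // ler_wpM2l ?ler0n.
  have -> : a * (2 * w ^+ k) * b * 2 ^+ k = b * (2 * 2 ^+ k) * a * w ^+ k by ring.
  by rewrite ler_wpM2r // exprn_ge0 // ltW.
(* For [k = 1] both sides equal 2(n+1). *)
have h0 : h = 0%N by lia.
rewrite ek /w /lam h0 expr0 mulr1 !expr1 /B ek.
have [-> ->] : ((2 * 1).-1 + 1)`! = 2%N /\ (2 * 1).-1`! = 1%N by [].
by rewrite -!natrM ler_nat; lia.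
Qed.

(** * Choice of the threshold and combination of the bounds *)

Theorem mainTheorem2 (k : nat) (hk : (0 < k)%N) :
  exists n0 : nat, forall (n : nat), (n0 <= n)%N ->
  forall (t : int) (S : {set cube n}),
    ((\sum_(n - (k.-1)./2 <= r < (n + uphalf k.-1).+1) ell n r)%N%:Z + t
       <= (#|S|)%:Z)%R ->
    (((ell n (3 * k).-1)%:R / (ell n (2 * k).-1)%:R - 1) * (t%:~R : rat)
       <= (ncomp S)%:R)%R.
Proof.
(* The cubic threshold serves the Bernoulli estimate; it also gives 10k <= n, which keeps rank 3k-1
   below n/2, where level sizes increase. *)
exists (10 * k ^ 3)%N => n len t S.
have len' : (10 * k <= n)%N by apply: leq_trans len; rewrite !expnS; nia.
set f := (k.-1)./2; set h := uphalf k.-1 => cardS.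
have eh : (f + h)%N = k.-1 by rewrite /f /h; lia.
have fh : (f <= h <= f.+1)%N by rewrite /f /h; lia.
have hn : (2 * h < n)%N by lia.
have := @supersaturation_weighted n h f k S fh ltac:(lia) hn.
set Mid := [set x | _]; set M := k`!%:R * _ => sat.
have cardMid : (\sum_(n - f <= r < (n + h).+1) ell n r = #|Mid|)%N.
  rewrite -sum1_card (eq_bigl (fun x => n - f <= csum x < (n + h).+1)%N); last first.
    by move=> x; rewrite inE.
  rewrite -(sum_levels (fun=> 1%N)); apply: eq_bigr => r _.
  by rewrite /ell -sum1_card; apply: eq_bigl => x; rewrite inE.
have tM : t%:~R <= M * (ncomp S)%:R.
  apply: le_trans sat; rewrite lerBrDl.
  by move: cardS; rewrite cardMid -(ler_int rat) intrD.
have ratio := @ratio_bound n k h hk ltac:(lia) len; rewrite -/M in ratio.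
set q := _ / _ in ratio *.
have q1 : 1 <= q.
  rewrite ler_pdivlMr ?ltr0n ?ell_gt0 //; last by lia.
  by rewrite mul1r ler_nat ell_mono //; lia.
have M0 : 0 <= M.
  by rewrite mulr_ge0 ?ler0n // exprn_ge0 // divr_ge0 ?divr_ge0 ?ler0n // ltW // lam_gt0.
apply: le_trans (_ : (q - 1) * (M * (ncomp S)%:R) <= _).
  by rewrite ler_wpM2l // subr_ge0.
(* From qM <= 1 and M >= 0 follows (q-1)M <= 1. *)
rewrite mulrA ler_piMl ?ler0n // mulrBl mul1r; lra.
Qed.
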